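(* Let $r\ge 2$ and $c\ge 5$ be integers and let $G_{r,c}$ be a balanced $c$-partite tournament with every partite set of size $r$, such that for some integer $q\ge 0$, $$\delta(G_{r,c})\ \ge\ q\big(r+\mu(G_{r,c})\big)\left(\frac{c-1}{c-2}\right).$$ Then, for every $x\in V(G_{r,c})$, $$T_q^+(x)\ \le\ \sum_{k=0}^{q}\binom{c-1}{k}\left(\frac{d^+(x)}{c-1}\right)^{k}\left(\frac{d^-(x)}{c-1}\right)^{c-1-k}.$$
   Context: A $c$-partite tournament is a digraph obtained from a complete $c$-partite graph, with partite sets $V_1,\dots,V_c$, by orienting each edge (in exactly one direction). It is balanced if all partite sets have the same number of vertices; $G_{r,c}$ denotes a balanced $c$-partite tournament with $|V_i|=r$ for every $i\in[c]=\{1,\dots,c\}$. A maximal tournament of $G_{r,c}$ is a subtournament of order $c$, i.e. a tournament induced by a choice of exactly one vertex from each partite set. For a vertex $x$ and an integer $q\ge 0$, $T_q^+(x)$ is the number of maximal tournaments of $G_{r,c}$ that contain $x$ and in which $x$ has out-degree at most $q$. For a vertex $x$ of a digraph, $d^+(x)$ and $d^-(x)$ are its out-degree and in-degree. For an oriented graph $D$, $\delta(D)=\min_{x\in V(D)}\min\{d^+(x),d^-(x)\}$. For a vertex $x$ of a $c$-partite tournament $D$ and $i\in[c]$, let $d_i^+(x)=|V_i\cap N^+(x)|$ and $d_i^-(x)=|V_i\cap N^-(x)|$, where $N^+(x)$, $N^-(x)$ are the out- and in-neighbourhoods of $x$. The local partite irregularity of $D$ is $$\mu(D)=\max_{x\in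 V(D)}\max_{i\in[c]}|d_i^+(x)-d_i^-(x)|.$$ *)

(* Defs.v *)
From mathcomp Require Import all_boot all_order all_algebra.
Set Implicit Arguments.
Unset Strict Implicit.
Unset Printing Implicit Defensive.

Section Digraph.

Variables (V : finType) (arc : rel V).

Definition out_nbrs (x : V) : {set V} := [set y | arc x y].
Definition in_nbrs (x : V) : {set V} := [set y | arc y x].

Definition outdeg (x : V) : nat := #|out_nbrs x|.
Definition indeg (x : V) : nat := #|in_nbrs x|.

(* The neutral value #|V| bounds every degree from above, so it is attained  *)
(* only when V is empty.                                                     *)
Definition min_semidegree : nat :=
  \big[minn/#|V|]_(x : V) minn (outdeg x) (indeg x).

End Digraph.

Section Multipartite.

Variables (c : nat) (V : finType) (part : V -> 'I_c) (arc : rel V).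

Definition partite_set (i : 'I_c) : {set V} := [set x | part x == i].

(* The boolean sum (+) is exclusive or: exactly one of the two arcs is       *)
(* present.                                                                  *)
Definition multipartite_tournament : Prop :=
  (forall x y, part x = part y -> ~~ arc x y) /\
  (forall x y, part x != part y -> arc x y (+) arc y x).

Definition balanced (r : nat) : Prop := forall i, #|partite_set i| = r.

Definition outdeg_in (i : 'I_c) (x : V) : nat :=
  #|partite_set i :&: out_nbrs arc x|.
Definition indeg_in (i : 'I_c) (x : V) : nat :=
  #|partite_set i :&: in_nbrs arc x|.

(* `|m - n|%N is the distance between m and n, the subtraction being that    *)
(* of int.                                                                   *)
Definition local_partite_irregularity : nat :=
  \max_(x : V) \max_(i < c) `|outdeg_in i x - indeg_in i x|%N.

(* A maximal tournament is an induced subdigraph, hence is identified with   *)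
(* its vertex set.                                                           *)
Definition maximal_tournament (S : {set V}) : bool :=
  [forall i : 'I_c, #|partite_set i :&: S| == 1].

Definition T_plus (q : nat) (x : V) : nat :=
  #|[set S : {set V} | [&& maximal_tournament S, x \in S
                         & #|out_nbrs arc x :&: S| <= q]]|.

End Multipartite.

(* Main.v *)
(* Choosing one vertex from each partite set other than that of x, the       *)
(* number of choices with k out-neighbours of x is the coefficient of X^k in *)
(* \prod_i (s_i + p_i X), with p_i and s_i the numbers of out- and           *)
(* in-neighbours of x in V_i, so that p_i + s_i = r. As in Hoeffding's       *)
(* theorem, the sum of the coefficients of degree at most q grows when some  *)
(* p_i above the mean a and some p_j below it are replaced by a and          *)
(* p_i + p_j - a: the gain is a nonnegative multiple of Q_q - Q_(q-1), with  *)
(* Q the product over the other indices. This difference is nonnegative if   *)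
(* \sum_(i notin T) p_i / s_i >= q for every T with q - 1 elements. Put      *)
(* h = r + mu and M = c - 2. The degree hypothesis reads q h <= M a, and p_i *)
(* and s_i are at most h / 2; since p_j <= a, the sum of p_i over the M - q  *)
(* indices outside T is at least q h / 2. If M h <= 2 r (M - q), the bound   *)
(* s_i <= h / 2 alone suffices; otherwise the convexity of 1 / s does.       *)

Require Import Defs.
From mathcomp Require Import all_boot all_order all_algebra.
From mathcomp Require Import ring lra zify.
Import Order.TTheory GRing.Theory Num.Theory.
Local Open Scope ring_scope.

Set Implicit Arguments.
Unset Strict Implicit.

(** Maximal tournaments through [x] are sorted by the set J of partite sets in which they meet the
    out-neighbourhood of [x]; this bounds their number by a partial coefficient sum
    ([T_plus_le_coef_psum]). Smoothing moves all factors to their mean ([coef_psum_le_mean]), where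
    the sum is binomial. The sign of one move ([coef_psum_exchange]) depends on two consecutive
    coefficients ([coef_prod_linear_nondecreasing]), hence on a sum of odds p / s
    ([sum_odds_ge]). *)

(** * Consecutive coefficients of a product of linear factors *)

Lemma coef_prod_linear (R : comNzRingType) (I : finType) (p s : I -> R)
    (k : nat) :
  (\prod_i (p i *: 'X + (s i)%:P))`_k =
  \sum_(J : {set I} | #|J| == k) \prod_i (if i \in J then p i else s i).
Proof.
rewrite bigA_distr coef_sum [RHS]big_mkcond; apply: eq_bigr => J _ /=.
have -> : \prod_i (if i \in J then p i *: 'X else (s i)%:P) =
    (\prod_i (if i \in J then p i else s i))%:P * 'X^#|J|.
  rewrite rmorph_prod -sum1_card (big_morph _ (exprD 'X) (expr0 'X)).
  rewrite [X in _ * X]big_mkcond -big_split /=; apply: eq_bigr => i _.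
  by case: (i \in J); rewrite ?mulr1 // -mul_polyC expr1.
by rewrite coefCM coefXn eq_sym; case: eqP; rewrite ?mulr1 ?mulr0.
Qed.

(** Double counting: each J with k + 1 elements is [i |: T] in k + 1 ways, and the weight of
    [i |: T] is p i / s i times that of T. *)
Lemma coef_prod_linear_nondecreasing (R : realFieldType) (I : finType)
    (p s : I -> R) (k : nat) :
  (forall i, 0 <= p i) -> (forall i, 0 <= s i) ->
  (forall T : {set I}, #|T| = k -> (forall i, i \notin T -> 0 < s i) ->
     k.+1%:R <= \sum_(i | i \notin T) p i / s i) ->
  (\prod_i (p i *: 'X + (s i)%:P))`_k <=
  (\prod_i (p i *: 'X + (s i)%:P))`_k.+1.
Proof.
move=> p0 s0 ratio; rewrite !coef_prod_linear.
set w := fun J : {set I} => \prod_i (if i \in J then p i else s i).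
have w0 J : 0 <= w J by apply: prodr_ge0 => i _; case: ifP.
have wU (T : {set I}) i : i \notin T -> w (i |: T) * s i = p i * w T.
  move=> iT; rewrite /w (bigD1 i) //= [in RHS](bigD1 i) //= setU11 (negPf iT).
  rewrite mulrA mulrAC; congr (_ * _ * _).
  apply: eq_bigr => j ji; by rewrite in_setU1 (negPf ji).
have countU : k.+1%:R * \sum_(J : {set I} | #|J| == k.+1) w J =
    \sum_(T : {set I} | #|T| == k) \sum_(i | i \notin T) w (i |: T).
  rewrite mulr_sumr.
  under eq_bigr => J /eqP <- do rewrite mulr_natl -sumr_const.
  rewrite (exchange_big_dep xpredT) //= [RHS](exchange_big_dep xpredT) //=.
  apply: eq_bigr => i _.
  rewrite (reindex_onto (fun T => i |: T) (fun J => J :\ i)); last first.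
    by move=> J /andP[_ iJ]; rewrite setD1K.
  apply: eq_bigl => T; rewrite setU11 andbT.
  have [iT|iT] /= := boolP (i \in T).
    rewrite andbF; apply/negbTE; rewrite negb_and orbC; apply/orP; left.
    by apply/eqP => /setP/(_ i); rewrite in_setD1 eqxx iT.
  by rewrite cardsU1 iT setU1K // eqxx.
rewrite -(ler_pM2l (ltr0Sn R k)) countU mulr_sumr.
apply: ler_sum => T /eqP cT.
(* If s vanishes somewhere outside T, so does the weight of T; hence [ratio] may ask for positive
   s. *)
have [/existsP[i /andP[iT /eqP si]]|] :=
  boolP [exists i, (i \notin T) && (s i == 0)].
  rewrite [X in _ * X](_ : _ = 0) ?mulr0 ?sumr_ge0 //.
  by rewrite (bigD1 i) //= (negPf iT) si mul0r.
rewrite negb_exists => /forallP sn0.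
have spos i : i \notin T -> 0 < s i.
  by move=> iT; rewrite lt0r s0 andbT; have := sn0 i; rewrite iT.
apply: le_trans (ler_wpM2r (w0 T) (ratio T cT spos)) _.
rewrite mulr_suml; apply: ler_sum => i iT.
rewrite mulrAC -wU // mulfK ?lexx // gt_eqF //; exact: spos.
Qed.

(** With s = rho - p, the odds are rho / s - 1. Either s <= h / 2 alone suffices, or the mean of s
    is at most rho N / (N + q), where N is the size of A, and Jensen's inequality for 1 / s
    concludes. *)
Lemma sum_odds_ge (R : realFieldType) (I : finType) (A : {set I}) (p : I -> R)
    (rho h : R) (q : nat) :
  0 < rho -> 0 < h ->
  {in A, forall i, 0 < rho - p i} -> {in A, forall i, 2 * (rho - p i) <= h} ->
  q%:R * h <= 2 * \sum_(i in A) p i ->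
  q%:R <= \sum_(i in A) p i / (rho - p i).
Proof.
move=> rho0 h0 s0 sh sump.
have sum_const (x : R) : \sum_(i in A) x = #|A|%:R * x.
  by rewrite sumr_const mulr_natl.
have [Mh|Mh] := lerP ((#|A|%:R + q%:R) * h) (2 * rho * #|A|%:R).
  have ptwise : forall i, i \in A -> 2 * rho / h - 1 <= p i / (rho - p i).
    move=> i iA; have := s0 i iA; have := sh i iA.
    set s := rho - p i => sh_i s0_i.
    rewrite (_ : p i = rho - s) ?/s; last by lra.
    rewrite mulrBl divff ?gt_eqF // lerD2r ler_pdivrMr // mulrAC.
      by rewrite ler_pdivlMr // -mulrA mulrCA ler_wpM2l // ltW.
  apply: le_trans _ (ler_sum _ ptwise); rewrite sum_const mulrBr mulr1 lerBrDr.
  by rewrite addrC mulrA ler_pdivlMr // (mulrC #|A|%:R).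
have [A0|A0] := posnP #|A|.
  move: sump; rewrite (cards0_eq A0) !big_set0 mulr0 pmulr_lle0 //.
have N0 : 0 < #|A|%:R :> R by rewrite ltr0n.
have Npos := ler0n R q.
set N : R := #|A|%:R in Mh N0 sum_const *.
set M := N + q%:R in Mh.
(* Tangent line of 1/s at the value rho N / M, in terms of its inverse tau. *)
pose tau := M / (N * rho).
have tauE : N * rho * tau = M by rewrite /tau mulrC divfK // gt_eqF // mulr_gt0.
clearbody tau.
have ptwise i : i \in A ->
    2 * rho * tau - rho * tau ^+ 2 * (rho - p i) - 1 <= p i / (rho - p i).
  move=> iA; have := s0 i iA; rewrite -{3}(subKr rho (p i)).
  move: (rho - p i) => s s_gt0.
  rewrite mulrBl divff ?gt_eqF // lerD2r ler_pdivlMr //.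
  have : 0 <= rho * (1 - tau * s) ^+ 2 by rewrite mulr_ge0 ?sqr_ge0 // ltW.
  by lra.
apply: le_trans _ (ler_sum _ ptwise).
rewrite !big_split /= !sumrN !sum_const -mulr_sumr big_split /= sumrN.
rewrite sum_const mulr1.
set L := \sum_(i in A) p i in sump *.
suff : rho * tau ^+ 2 * (N * rho - L) <= M by rewrite /M in tauE *; lra.
have M0 : 0 < M by rewrite /M; lra.
have ML : M * (N * rho - L) <= N ^+ 2 * rho.
  have : q%:R * (2 * rho * N) <= M * (2 * L).
    apply: le_trans (ler_wpM2l (ltW M0) sump).
    by rewrite [leRHS]mulrCA ler_wpM2l // ltW.
  by rewrite /M; lra.
rewrite -(ler_pM2l (mulr_gt0 N0 (mulr_gt0 N0 rho0))).
have -> : N * (N * rho) * (rho * tau ^+ 2 * (N * rho - L)) =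
   M * (M * (N * rho - L)) by rewrite -tauE; ring.
apply: le_trans (ler_wpM2l (ltW M0) ML) _.
by rewrite le_eqVlt (_ : _ == _) //; apply/eqP; ring.
Qed.

(** * Hoeffding smoothing of partial coefficient sums *)

Section Smoothing.

Variables (R : realFieldType) (rho h : R).
Hypotheses (rho_gt0 : 0 < rho) (h_gt0 : 0 < h).

(* For rho = 1, the generating polynomial of a sum of independent Bernoulli  *)
(* variables with parameters l.                                              *)
Definition gen_poly (l : seq R) : {poly R} :=
  \prod_(p <- l) (p *: 'X + (rho - p)%:P).

Definition coef_psum (q : nat) (P : {poly R}) : R := \sum_(k < q.+1) P`_k.

(** With s = rho - p, the last two bounds say that p and s differ by at most h - rho. *)
Definition admissible (p : R) : bool :=
  [&& 0 <= p, p <= rho, 2 * p <= h & 2 * (rho - p) <= h].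

(** Partial sums of coefficients are the coefficients of P / (1 - X). *)
Lemma coef_psum_1subX (q : nat) (P : {poly R}) :
  coef_psum q ((1 - 'X) * P) = P`_q.
Proof.
rewrite /coef_psum mulrBl mul1r; elim: q => [|q IHq].
  by rewrite big_ord1 coefB coefXM subr0.
by rewrite big_ord_recr IHq /= coefB coefXM /= addrCA subrr addr0.
Qed.

Lemma coef_gen_poly_nondecreasing (l : seq R) (q : nat) :
  all admissible l -> (2 * q%:R - 1) * h <= 2 * \sum_(p <- l) p ->
  0 <= ((1 - 'X) * gen_poly l)`_q.
Proof.
move=> /allP adm suml; rewrite mulrBl mul1r coefB coefXM subr_ge0.
pose p i := tnth (in_tuple l) i.
have admp i : admissible (p i) by apply: adm; apply: mem_tnth.
have p0 i : 0 <= p i by case/and4P: (admp i).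
have s0 i : 0 <= rho - p i by rewrite subr_ge0; case/and4P: (admp i).
have -> : gen_poly l = \prod_i (p i *: 'X + (rho - p i)%:P).
  by rewrite /gen_poly big_tnth.
case: q suml => [|q] suml /=.
  rewrite coef_prod_linear; apply: sumr_ge0 => J _; apply: prodr_ge0 => i _.
  by case: ifP.
apply: coef_prod_linear_nondecreasing => // T cT sT.
have setCE (F : 'I_(size l) -> R) :
    \sum_(i | i \notin T) F i = \sum_(i in ~: T) F i.
  by apply: eq_bigl => i; rewrite in_setC.
rewrite setCE; apply: (@sum_odds_ge _ _ _ _ _ h) => // [i|i _|].
- by rewrite in_setC => /sT.
- by case/and4P: (admp i).
(* Of the (2 q + 1) h available, T takes at most q h, which leaves (q + 1) h. *)
have : 2 * \sum_(i in T) p i <= q%:R * h.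
  rewrite mulr_sumr -cT mulr_natl -sumr_const; apply: ler_sum => i _.
  by case/and4P: (admp i).
move: suml; rewrite big_tnth (bigID [in T]) /=.
by rewrite setCE -natr1; lra.
Qed.

Lemma coef_psumB (q : nat) (P Q : {poly R}) :
  coef_psum q (P - Q) = coef_psum q P - coef_psum q Q.
Proof.
by rewrite /coef_psum -sumrB; apply: eq_bigr => k _; rewrite coefB.
Qed.

Lemma coef_psumZ (q : nat) (x : R) (P : {poly R}) :
  coef_psum q (x *: P) = x * coef_psum q P.
Proof.
by rewrite /coef_psum mulr_sumr; apply: eq_bigr => k _; rewrite coefZ.
Qed.

(* With p + s = rho fixed, p X + s = rho - p (1 - X), so a product of two    *)
(* factors with b + d fixed depends on b d through b d (1 - X)^2 only.       *)
Lemma coef_psum_exchange (q : nat) (a b d : R) (l : seq R) :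
  b * d <= a * (b + d - a) -> 0 <= ((1 - 'X) * gen_poly l)`_q ->
  coef_psum q (gen_poly [:: b, d & l]) <=
  coef_psum q (gen_poly [:: a, b + d - a & l]).
Proof.
move=> bd ql; rewrite -subr_ge0 -coef_psumB.
have -> : gen_poly [:: a, b + d - a & l] - gen_poly [:: b, d & l] =
    (a * (b + d - a) - b * d) *: ((1 - 'X) * ((1 - 'X) * gen_poly l)).
  rewrite /gen_poly !big_cons -!mul_polyC !(rmorphB, rmorphD, rmorphM) /=.
  by ring.
by rewrite coef_psumZ coef_psum_1subX mulr_ge0 // subr_ge0.
Qed.

Lemma sum_eq0_has_gt0 (I : eqType) (l : seq I) (F : I -> R) :
  \sum_(i <- l) F i = 0 -> has (fun i => F i != 0) l ->
  exists2 i, i \in l & 0 < F i.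
Proof.
move=> sum0 /hasP[j jl Fj]; apply/hasP; apply: contraNT Fj => /hasPn le0.
have : \sum_(i <- l | i \in l) - F i == 0.
  by rewrite -big_seq sumrN sum0 oppr0.
rewrite psumr_eq0 => [/allP/(_ j jl)|i il]; first by rewrite jl oppr_eq0.
by rewrite oppr_ge0 leNgt le0.
Qed.

(* Hoeffding's smoothing: replacing some b > a > d by a and b + d - a brings *)
(* one more entry to the mean a.                                             *)
Lemma coef_psum_le_mean (q : nat) (a : R) (l : seq R) :
  all admissible l -> \sum_(p <- l) p = (size l)%:R * a ->
  q%:R * h <= ((size l)%:R - 1) * a ->
  coef_psum q (gen_poly l) <= coef_psum q (gen_poly (nseq (size l) a)).
Proof.
move: {2}(count _ l) (leqnn (count (predC1 a) l)) => m.
elim: m l => [|m IHm] l cm adm suml qh.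
  move: cm; rewrite leqn0 -leqn0 leqNgt -has_count has_predC negbK.
  by move=> /all_pred1P {1}->.
have [/all_pred1P {1}-> //|] := boolP (all (pred1 a) l).
rewrite -has_predC => nconst.
have sub0 : \sum_(p <- l) (p - a) = 0.
  by rewrite sumrB suml big_const_seq count_predT iter_addr_0 mulr_natl subrr.
have [|b bl ab] := @sum_eq0_has_gt0 _ l (fun p => p - a) sub0.
  by apply: sub_has nconst => p; rewrite /= subr_eq0.
have [||d dl da] := @sum_eq0_has_gt0 _ l (fun p => a - p).
- by under eq_bigr => p _ do rewrite -opprB; rewrite sumrN sub0 oppr0.
- by apply: sub_has nconst => p; rewrite /= subr_eq0 eq_sym.
rewrite subr_gt0 in ab; rewrite subr_gt0 in da.
have bd : d != b by rewrite lt_eqF // (lt_trans da).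
set l' := rem d (rem b l).
have perm_l : perm_eq l [:: b, d & l'].
  rewrite (perm_trans (perm_to_rem bl)) // perm_cons perm_to_rem //.
  move: dl; rewrite (perm_mem (perm_to_rem bl)) in_cons (negPf bd) //.
have size_l : size l = (size l').+2 by rewrite (perm_size perm_l).
move: adm suml cm qh; rewrite (perm_all _ perm_l) (perm_big _ perm_l) /=.
rewrite (permP perm_l) !big_cons /= size_l -!natr1 => /and3P[adb add adl'].
rewrite (gt_eqF ab) (lt_eqF da) => suml cm qh.
(* Admissibility is an interval condition, and both new entries lie between d and b. *)
have admid p : d <= p -> p <= b -> admissible p.
  case/and4P: adb => b1 b2 b3 b4; case/and4P: add => d1 d2 d3 d4 dp pb.
  by apply/and4P; split; lra.
apply: (@le_trans _ _ (coef_psum q (gen_poly [:: a, b + d - a & l']))).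
  rewrite {1}/gen_poly (perm_big _ perm_l) -/(gen_poly _).
  apply: coef_psum_exchange.
    rewrite -subr_ge0 (_ : _ - _ = (b - a) * (a - d)); last by ring.
    by rewrite mulr_ge0 // subr_ge0 ltW.
  (* Removing b and d costs at most h / 2 + a, since 2 b <= h and d < a. *)
  apply: coef_gen_poly_nondecreasing => //.
  by case/and4P: adb => *; lra.
have := IHm [:: a, b + d - a & l']; rewrite /= !big_cons -!natr1; apply => //.
- by rewrite eqxx /=; move: cm => /=; case: (_ != _); lia.
- by rewrite !admid //; lra.
- by lra.
Qed.

Lemma coef_psum_gen_poly_nseq (q n : nat) (a : R) :
  coef_psum q (gen_poly (nseq n a)) =
  \sum_(0 <= k < q.+1) 'C(n, k)%:R * a ^+ k * (rho - a) ^+ (n - k).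
Proof.
rewrite /coef_psum big_mkord; apply: eq_bigr => k _.
rewrite /gen_poly big_nseq iter_mulr_1 addrC exprDn coef_sum.
have coefE i : (((rho - a)%:P ^+ (n - i) * (a *: 'X) ^+ i) *+ 'C(n, i))`_k =
    (i == k)%:R * ('C(n, k)%:R * a ^+ k * (rho - a) ^+ (n - k)).
  rewrite coefMn -rmorphXn coefCM exprZn coefZ coefXn eq_sym.
  case: eqP => [->|_]; last by rewrite !(mulr0, mul0r) mul0rn.
  by rewrite mulr1 mul1r mulrC -mulrnAl -mulr_natl.
under eq_bigr => i _ do rewrite coefE.
have [nk|kn] := ltnP n k.
  by rewrite bin_small // !mul0r big1 // => i _; rewrite mulr0.
rewrite (bigD1 (Ordinal (kn : (k < n.+1)%N))) //= eqxx mul1r big1 ?addr0 //.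
by move=> i; rewrite -val_eqE /= => /negPf ->; rewrite mul0r.
Qed.

End Smoothing.

(** * Counting maximal tournaments through a vertex *)

Section Transversals.

Variables (r c : nat) (V : finType) (part : V -> 'I_c) (arc : rel V).
Hypotheses (hG : multipartite_tournament part arc) (hbal : balanced part r).
Variables (q : nat) (x : V).

Local Notation d_out i := (outdeg_in part arc i x).
Local Notation d_in i := (indeg_in part arc i x).
Local Notation mu := (local_partite_irregularity part arc).

Lemma min_semidegree_le_outdeg : (min_semidegree arc <= outdeg arc x)%N.
Proof.
have := @bigmin_le _ nat _ #|V| x (fun y => minn (outdeg arc y) (indeg arc y)).
by move/leq_trans; apply; rewrite geq_minl.
Qed.

Lemma sum_card_partite_setI (A : {set V}) :
  (\sum_i #|partite_set part i :&: A| = #|A|)%N.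
Proof.
rewrite -[RHS]sum1_card (partition_big part xpredT) //=; apply: eq_bigr => i _.
by rewrite -sum1_card; apply: eq_bigl => y; rewrite !inE andbC.
Qed.

Lemma outdeg_in_own_part : d_out (part x) = 0.
Proof.
apply/eqP; rewrite cards_eq0; apply/eqP/setP => y; rewrite !inE.
by apply/negP => /andP[/eqP/esym/(proj1 hG) /negPf->].
Qed.

Lemma indeg_in_own_part : d_in (part x) = 0.
Proof.
apply/eqP; rewrite cards_eq0; apply/eqP/setP => y; rewrite !inE.
by apply/negP => /andP[/eqP/(proj1 hG) /negPf->].
Qed.

Lemma outdeg_sum : outdeg arc x = (\sum_(i | i != part x) d_out i)%N.
Proof.
rewrite /outdeg -sum_card_partite_setI (bigD1 (part x)) //=.
by rewrite [X in (X + _)%N]outdeg_in_own_part.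
Qed.

Lemma indeg_sum : indeg arc x = (\sum_(i | i != part x) d_in i)%N.
Proof.
rewrite /indeg -sum_card_partite_setI (bigD1 (part x)) //=.
by rewrite [X in (X + _)%N]indeg_in_own_part.
Qed.

Lemma outdeg_in_add_indeg_in (i : 'I_c) :
  i != part x -> (d_out i + d_in i = r)%N.
Proof.
move=> ix; rewrite -(hbal i) -[RHS](cardsID (out_nbrs arc x)); congr (_ + _)%N.
apply: eq_card => y; rewrite !inE andbC [RHS]andbC.
have [/eqP yi|] := boolP (part y == i); last by rewrite !andbF.
by move/(_ x y): (proj2 hG); rewrite yi eq_sym => /(_ ix); do 2!case: arc.
Qed.

Lemma outdeg_in_dist (i : 'I_c) :
  (d_out i <= d_in i + mu)%N /\ (d_in i <= d_out i + mu)%N.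
Proof.
have dist : (`|d_out i - d_in i|%N <= mu)%N.
  apply: leq_trans (leq_bigmax x); exact: (leq_bigmax i).
lia.
Qed.

(** Adding [x] to its in-neighbours makes [x] the only choice in its own part when that part is not
    in J. *)
Definition choices (J : {set 'I_c}) (i : 'I_c) : {set V} :=
  if i \in J then partite_set part i :&: out_nbrs arc x
  else partite_set part i :&: (x |: in_nbrs arc x).

Lemma card_transversals_le (J : {set 'I_c}) :
  (#|[set S | maximal_tournament part S & (x \in S) &&
       ([set i | partite_set part i :&: out_nbrs arc x :&: S != set0] == J)]|
   <= \prod_i #|choices J i|)%N.
Proof.
have -> : (\prod_i #|choices J i| = #|family (fun i => mem (choices J i))|)%N.
  by rewrite card_family foldrE big_image.
apply: leq_trans (leq_imset_card (fun f : {ffun 'I_c -> V} => f @: setT) _).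
apply: subset_leq_card; apply/subsetP => S; rewrite inE.
case/and3P=> /forallP maxS xS /eqP defJ.
(* The default [x] never occurs: S meets every part. *)
pose f := [ffun i => odflt x [pick y in partite_set part i :&: S]].
have fP i : partite_set part i :&: S = [set f i].
  have /cards1P[y yS] := maxS i; rewrite yS /f ffunE.
  case: pickP => [z|/(_ y)] /=; rewrite yS in_set1 ?eqxx // => /eqP-> //.
have fS i : (part (f i) == i) && (f i \in S).
  by have := set11 (f i); rewrite -fP !inE.
have uniqf i y : part y = i -> y \in S -> y = f i.
  by move=> yi yS; apply/set1P; rewrite -fP !inE yi eqxx.
apply/imsetP; exists f.
  apply/familyP => i; rewrite /choices -defJ inE /=.
  have /andP[pfi fiS] := fS i.
  case: ifPn => [/set0Pn[y]|].
    rewrite !inE => /andP[/andP[/eqP yi xy] yS].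
    by rewrite pfi -(uniqf i y).
  rewrite negbK => /eqP/setP/(_ (f i)); rewrite !inE pfi fiS /= andbT => nxf.
  have [xi|xi] := eqVneq (part x) i; first by rewrite -(uniqf i x) ?eqxx.
  rewrite eq_sym -(eqP pfi) in xi.
  by have := proj2 hG _ _ xi; rewrite nxf addbF => ->; rewrite orbT.
apply/setP => y; apply/idP/imsetP => [yS|[i _ ->]].
  by exists (part y); rewrite ?inE //; apply: uniqf.
by case/andP: (fS i).
Qed.

Lemma T_plus_le :
  (T_plus part arc q x <=
   \sum_(J : {set 'I_c} | #|J| <= q) \prod_i #|choices J i|)%N.
Proof.
pose out_parts (S : {set V}) :=
  [set i | partite_set part i :&: out_nbrs arc x :&: S != set0].
rewrite /T_plus -sum1_card (partition_big out_parts (fun J => #|J| <= q)%N) /=.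
  apply: leq_sum => J _; apply: leq_trans (card_transversals_le J).
  rewrite sum1_card; apply: subset_leq_card; apply/subsetP => S.
  rewrite unfold_in !inE => /andP[/and3P[-> -> _] /eqP <-].
  by rewrite eqxx.
(* Each index in [out_parts S] is the part of an out-neighbour of [x] in S. *)
move=> S; rewrite inE => /and3P[_ _ Sq]; apply: leq_trans Sq.
apply: leq_trans (leq_imset_card part _); apply: subset_leq_card.
apply/subsetP => i; rewrite inE => /set0Pn[y]; rewrite !inE.
by move=> /andP[/andP[/eqP <- xy] yS]; apply: imset_f; rewrite !inE xy yS.
Qed.

Lemma card_choices_notin (J : {set 'I_c}) (i : 'I_c) : i \notin J ->
  #|choices J i| = if i == part x then 1%N else d_in i.
Proof.
rewrite /choices => /negPf ->; rewrite setIUr.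
case: eqVneq => [->|ix].
  have /eqP := indeg_in_own_part; rewrite cards_eq0 => /eqP ->.
  rewrite setU0 -(cards1 x); apply: eq_card => y; rewrite !inE.
  by have [->|_] := eqVneq y x; rewrite ?eqxx ?andbF.
rewrite (_ : _ :&: [set x] = set0) ?set0U //.
apply/setP => y; rewrite !inE.
by apply/negP => /andP[/eqP yi /eqP yx]; rewrite -yi yx eqxx in ix.
Qed.

Lemma T_plus_le_coef_psum (R : realFieldType) :
  (T_plus part arc q x)%:R <= coef_psum q (gen_poly r%:R
    [seq (d_out i)%:R | i <- enum 'I_c & i != part x]) :> R.
Proof.
pose p i : R := (d_out i)%:R.
(* The part of [x] contributes the trivial factor 0 X + 1. *)
pose s i : R := if i == part x then 1 else (d_in i)%:R.
have -> : gen_poly r%:R [seq (d_out i)%:R | i <- enum 'I_c & i != part x] =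
    \prod_i (p i *: 'X + (s i)%:P).
  rewrite /gen_poly big_map big_filter big_enum_cond /=.
  rewrite [RHS](bigD1 (part x)) //= /p /s outdeg_in_own_part eqxx.
  rewrite scale0r add0r mul1r; apply: eq_bigr => i ix.
  by rewrite (negPf ix) -(outdeg_in_add_indeg_in ix) natrD addrAC subrr add0r.
have <- : \sum_(J : {set 'I_c} | (#|J| <= q)%N)
      \prod_i (if i \in J then p i else s i) =
    coef_psum q (\prod_i (p i *: 'X + (s i)%:P)).
  pose card_ord (J : {set 'I_c}) : 'I_q.+1 := inord #|J|.
  rewrite /coef_psum (partition_big card_ord xpredT) //=.
  apply: eq_bigr => k _; rewrite coef_prod_linear; apply: eq_bigl => J.
  have [Jq|Jq] := leqP; first by rewrite -val_eqE /= inordK.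
  by apply/esym/eqP => Jk; have := ltn_ord k; rewrite -Jk ltnS leqNgt Jq.
move: T_plus_le; rewrite -(ler_nat R) => /le_trans; apply.
rewrite natr_sum; apply: ler_sum => J _; rewrite natr_prod.
apply: ler_prod => i _; rewrite ler0n /=; case: ifPn => iJ.
  by rewrite /choices iJ.
by rewrite card_choices_notin // /s; case: ifP.
Qed.

End Transversals.

(** * From the degree hypothesis to the smoothing bound *)

Unset Implicit Arguments.
Set Strict Implicit.

Theorem theorem2 (r c : nat) (hr : (2 <= r)%N) (hc : (5 <= c)%N)
    (V : finType) (part : V -> 'I_c) (arc : rel V)
    (hG : multipartite_tournament part arc) (hbal : balanced part r)
    (q : nat)
    (hdelta : q%:R * (r%:R + (local_partite_irregularity part arc)%:R)
                * ((c%:R - 1) / (c%:R - 2))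
              <= (min_semidegree arc)%:R :> rat)
    (x : V) :
  (T_plus part arc q x)%:R
    <= \sum_(0 <= k < q.+1)
         'C(c - 1, k)%:R
         * ((outdeg arc x)%:R / (c%:R - 1)) ^+ k
         * ((indeg arc x)%:R / (c%:R - 1)) ^+ (c - 1 - k) :> rat.
Proof.
apply: le_trans (T_plus_le_coef_psum hG hbal q x _) _.
set l := [seq _ | _ <- _ & _].
set mu := local_partite_irregularity part arc in hdelta.
have r0 : 0 < r%:R :> rat by rewrite ltr0n; lia.
have h0 : 0 < r%:R + mu%:R :> rat by apply: ltr_wpDr.
have card_others : #|[pred i | i != part x]| = (c - 1)%N.
  by have := cardC1 (part x); rewrite card_ord subn1.
have size_l : size l = (c - 1)%N.
  rewrite size_map size_filter -card_others -sum1_card -sum1_count.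
  by rewrite big_enum_cond.
have cR : (c - 1)%:R = c%:R - 1 :> rat by rewrite natrB //; lia.
have c5 : 5 <= c%:R :> rat by rewrite ler_nat.
have sum_l : \sum_(p <- l) p = (outdeg arc x)%:R.
  by rewrite (outdeg_sum hG) natr_sum big_map big_filter big_enum_cond.
have degs : (outdeg arc x)%:R + (indeg arc x)%:R = (c%:R - 1) * r%:R :> rat.
  rewrite (outdeg_sum hG) (indeg_sum hG) -natrD -big_split /= -cR -natrM.
  rewrite (eq_bigr (fun=> r)) => [|i ix]; last exact: outdeg_in_add_indeg_in.
  by rewrite sum_nat_const card_others.
pose a : rat := (outdeg arc x)%:R / (c%:R - 1).
have aE : (c%:R - 1) * a = (outdeg arc x)%:R by rewrite mulrC divfK //; lra.
have -> : (indeg arc x)%:R / (c%:R - 1) = r%:R - a.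
  apply: (@mulfI _ (c%:R - 1)); first by lra.
  by rewrite mulrBr aE -degs mulrC divfK; lra.
rewrite -/a -coef_psum_gen_poly_nseq -size_l; clearbody a.
apply: (@coef_psum_le_mean _ _ (r%:R + mu%:R)) => //.
- apply/allP => z /mapP[i]; rewrite mem_filter => /andP[ix _] -> {z}.
  have [d1 d2] := outdeg_in_dist part arc x i.
  have := outdeg_in_add_indeg_in hG hbal ix.
  rewrite -!(ler_nat rat) !natrD -/mu in d1 d2 *.
  move=> /(congr1 (fun n => n%:R : rat)); rewrite natrD => ds.
  have p0 := ler0n rat (outdeg_in part arc i x).
  have s0 := ler0n rat (indeg_in part arc i x).
  by apply/and4P; split; rewrite ?p0 //; lra.
- by rewrite sum_l size_l cR aE.
(* As the out-degree is (c - 1) a, the hypothesis becomes q (r + mu) <= (c - 2) a, and c - 2 is one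
   less than the size of [l]. *)
have /(le_trans hdelta) : (min_semidegree arc)%:R <= (outdeg arc x)%:R :> rat.
  by rewrite ler_nat min_semidegree_le_outdeg.
have c1 : 0 < c%:R - 1 :> rat by lra.
rewrite size_l cR -aE mulrA ler_pdivrMr => [qh|]; last by lra.
by rewrite -(ler_pM2r c1); lra.
Qed.
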